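(* None of the following complete multipartite graphs is dimension-critical: (i) $K_2$; (ii) $G(\alpha, 1, 0)$ for any integer $\alpha \geq 1$; (iii) $G(\alpha, 1, 1)$ for any integer $\alpha \geq 1$; (iv) $G(\alpha, 2, 0)$ for any integer $\alpha \geq 1$; (v) $G(\alpha, 0, 1)$ for any integer $\alpha \geq 2$.
   Context: All graphs are finite and simple. A graph $G$ is representable (embeddable) in $\mathbb{R}^n$ if its vertices can be placed at distinct points of $\mathbb{R}^n$ so that any two adjacent vertices are at Euclidean distance exactly 1 (non-adjacent vertices are also allowed to be at distance 1). By convention, $\mathbb{R}^0$ is a single point, so a graph consisting of two isolated vertices is not representable in $\mathbb{R}^0$. The dimension $\dim(G)$ is the smallest integer $n \ge 0$ such that $G$ is representable in $\mathbb{R}^n$. A non-empty graph $G$ is dimension-critical if every proper subgraph $H$ of $G$ (not necessarily induced) satisfies $\dim(H) < \dim(G)$. For non-negative integers $\alpha,\beta,\gamma$, $G(\alpha,\beta,\gamma)$ denotes the complete multipartite graph with $\alpha+\beta+\gamma$ parts, of which $\alpha$ have size 1, $\beta$ have size 2, and $\gamma$ have size 3. *)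

(* Defs.v *)
From mathcomp Require Import all_boot all_order all_algebra.
From mathcomp Require Import boolp reals.

Set Implicit Arguments.
Unset Strict Implicit.
Unset Printing Implicit Defensive.

Import Order.TTheory GRing.Theory Num.Theory.
Local Open Scope ring_scope.

(* A graph is a pair (V, E) with V a subset of an ambient finite type T, so
   that the subgraphs of a graph are again graphs over T. *)
Record graph (T : finType) := Graph {
  verts : {set T};
  edges : {set {set T}};
  edgesP : forall e : {set T}, e \in edges -> e \subset verts /\ #|e| = 2%N
}.

Definition adj (T : finType) (G : graph T) (x y : T) : bool :=
  [set x; y] \in edges G.

Definition subgraph (T : finType) (H G : graph T) : Prop :=
  verts H \subset verts G /\ edges H \subset edges G.

Definition proper_subgraph (T : finType) (H G : graph T) : Prop :=
  subgraph H G /\ ~ (verts H = verts G /\ edges H = edges G).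

Definition edist (R : realType) (n : nat) (p q : 'rV[R]_n) : R :=
  Num.sqrt (\sum_(i < n) (p 0 i - q 0 i) ^+ 2).

(* Only the values of f on the vertices of G matter. *)
Definition representable (R : realType) (T : finType) (G : graph T) (n : nat)
  : Prop :=
  exists f : T -> 'rV[R]_n,
    {in verts G &, injective f} /\
    {in verts G &, forall x y, adj G x y -> edist (f x) (f y) = 1}.

(* The vertices of a regular simplex of side 1 represent any graph. *)
Lemma representable_card (R : realType) (T : finType) (G : graph T) :
  representable R G #|T|.
Proof.
pose c : R := Num.sqrt (2%:R^-1).
have c2 : c ^+ 2 = 2%:R^-1 by rewrite sqr_sqrtr // invr_ge0 ler0n.
have c0 : c != 0 by rewrite -sqrf_eq0 c2 invr_eq0 pnatr_eq0.
exists (fun x => \row_(i < #|T|) (c *+ (i == enum_rank x))); split.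
  move=> x y _ _ /rowP/(_ (enum_rank x)); rewrite !mxE eqxx mulr1n.
  by case: eqP => [/enum_rank_inj //|_] /eqP; rewrite mulr0n (negPf c0).
move=> x y _ _ /edgesP[_]; rewrite cards2; case: eqVneq => // xy _.
rewrite /edist (bigD1 (enum_rank x)) //= (bigD1 (enum_rank y)) /=; last first.
  by rewrite (inj_eq enum_rank_inj) eq_sym.
rewrite !mxE !eqxx !(inj_eq enum_rank_inj) (negPf xy) eq_sym (negPf xy).
rewrite !mulr0n !mulr1n subr0 sub0r sqrrN c2 big1 => [|i /andP[ix iy]].
  by rewrite addr0 -[2%:R^-1]mul1r -splitr sqrtr1.
by rewrite !mxE (negPf ix) (negPf iy) subr0 expr0n.
Qed.

Lemma ex_representable (R : realType) (T : finType) (G : graph T) :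
  exists n, `[< representable R G n >].
Proof. by exists #|T|; apply/asboolP/representable_card. Qed.

Definition graph_dim (R : realType) (T : finType) (G : graph T) : nat :=
  ex_minn (ex_representable R G).

Definition dimension_critical (R : realType) (T : finType) (G : graph T)
  : Prop :=
  verts G != set0 /\
  forall H : graph T, proper_subgraph H G -> (graph_dim R H < graph_dim R G)%N.

Lemma complete_edgesP (n : nat) (e : {set 'I_n}) :
  e \in [set e : {set 'I_n} | #|e| == 2%N] ->
  e \subset [set: 'I_n] /\ #|e| = 2%N.
Proof. by rewrite inE => /eqP ->; split => //; apply: subsetT. Qed.

Definition complete_graph (n : nat) : graph 'I_n :=
  Graph (@complete_edgesP n).

(* Parts are indexed by 'I_(a + b + c): the first a of them have size 1, the
   next b size 2, the last c size 3.  A vertex is a pair (part, element). *)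
Definition part_size (a b i : nat) : nat :=
  if (i < a)%N then 1%N else if (i < a + b)%N then 2%N else 3%N.

Definition Gvertex (a b c : nat) : finType :=
  {i : 'I_(a + b + c) & 'I_(part_size a b i)}.

Definition Gedges (a b c : nat) : {set {set Gvertex a b c}} :=
  [set e | [exists x : Gvertex a b c, exists y : Gvertex a b c,
             (tag x != tag y) && (e == [set x; y])]].

Lemma GedgesP (a b c : nat) (e : {set Gvertex a b c}) :
  e \in Gedges a b c -> e \subset [set: Gvertex a b c] /\ #|e| = 2%N.
Proof.
rewrite inE => /existsP[x /existsP[y /andP[xy /eqP->]]].
split; first exact: subsetT.
by rewrite cards2 (contraNneq _ xy) // => ->.
Qed.

Definition Gabc (a b c : nat) : graph (Gvertex a b c) := Graph (@GedgesP a b c).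

(* Main.v *)
Require Import Defs.
From mathcomp Require Import all_boot all_order all_algebra.
From mathcomp Require Import reals.
From mathcomp Require Import boolp zify ring lra.

(* In each case let H be obtained from G by deleting all the edges between two
   parts, i.e. by merging them (for K_2, H is two isolated vertices).

   Except for K_2, G lies in R^(|T| - 2), T the vertex set: vertices of different
   parts are put on different axes at distance 1/sqrt 2 from the origin, where
   two vertices of a part can share an axis; when all other parts are singletons,
   two vertices can even be put, without a new axis, on the line (t, ..., t)
   through the center of the simplex formed by the singletons.

   H does not lie in a smaller space. Let x be an affine dependency between the
   points of a representation of H. Expanding squares, sum_i x_i |p_i - p_j|^2
   does not depend on j, so the sum of x_i (|p_i - p_j|^2 - 1) over the class of
   j is a constant kappa. If H has a class {u, v, w} with no right angle at w
   and x_w = 0, the equations at u, v, w give x_u = x_v = 0 and kappa = 0, which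
   kills x on singleton classes. On a last class of at most 3 points, the sum of
   the x_i and all the sums of x_i |p_i - p_j|^2 are then 0, so x is 0 there too.
   Hence all the points but w are affinely independent. *)

Set Implicit Arguments.
Unset Strict Implicit.
Unset Printing Implicit Defensive.

Import Order.TTheory GRing.Theory Num.Theory.
Local Open Scope ring_scope.

(** * Complete multipartite graphs given by a labelling of the vertices *)

Section Multipartite.
Variables (T : finType) (c : T -> nat).

(** With classes encoded as labels, merging two parts only changes [c]; the vertex type stays the
    same. *)
Definition multipartite_edges : {set {set T}} :=
  [set e | [exists x, exists y, (c x != c y) && (e == [set x; y])]].

Lemma multipartite_edgesP (e : {set T}) :
  e \in multipartite_edges -> e \subset [set: T] /\ #|e| = 2%N.
Proof.
rewrite inE => /existsP[x /existsP[y /andP[xy /eqP->]]].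
split; first exact: subsetT.
by rewrite cards2 (contraNneq _ xy) // => ->.
Qed.

Definition multipartite : graph T := Graph multipartite_edgesP.

Lemma adj_multipartite x y : adj multipartite x y = (c x != c y).
Proof.
rewrite /adj inE; apply/existsP/idP => [[u /existsP[v /andP[uv /eqP e]]]|xy].
  apply: contraNneq uv => cxy.
  have: u \in [set x; y] by rewrite e set21.
  have: v \in [set x; y] by rewrite e set22.
  by rewrite !inE; do 2![case/orP=> /eqP->]; rewrite ?cxy.
by exists x; apply/existsP; exists y; rewrite xy eqxx.
Qed.

End Multipartite.

Lemma not_critical_multipartite (R : realType) (T : finType) (G : graph T)
    (c : T -> nat) N :
  verts G = [set: T] -> multipartite_edges c \proper edges G ->
  representable R G N ->
  (forall n, representable R (multipartite c) n -> (N <= n)%N) ->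
  ~ dimension_critical R G.
Proof.
move=> vG pr rep low [_ crit].
have: proper_subgraph (multipartite c) G.
  split; first by split; rewrite ?vG ?(proper_sub pr).
  by move=> [_ /= e]; move: pr; rewrite -e properxx.
move/crit; apply/negP; rewrite -leqNgt; apply: (@leq_trans N).
  by rewrite /graph_dim; case: ex_minnP => m _; apply; apply/asboolP.
by rewrite /graph_dim; case: ex_minnP => m /asboolP /low.
Qed.

(** * Affine dependencies and squared distances *)

Section LowerBound.
Variables (R : realType) (T : finType) (n : nat) (f : T -> 'rV[R]_n).

Definition affine_dependency (x : T -> R) :=
  \sum_i x i = 0 /\ forall k, \sum_i x i * f i 0 k = 0.

(** Append a coordinate 1 to each point of [A]: a vanishing combination of these rows is an affine
    dependency supported on [A], so the rows are free and their number is at most the number of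
    columns. *)
Lemma affine_independent_card (A : {set T}) :
  (forall x, affine_dependency x -> (forall i, i \notin A -> x i = 0) ->
     forall i, x i = 0) ->
  (#|A| <= n.+1)%N.
Proof.
move=> indep.
pose M : 'M[R]_(#|A|, n + 1) :=
  \matrix_(i < #|A|) row_mx (f (enum_val i)) (1 : 'rV_1).
suff /eqP <- : row_free M
  by have := rank_leq_col M; rewrite [X in (_ <= X)%N]addn1.
apply/inj_row_free => v /rowP vM.
pose x i := if [pick j : 'I_#|A| | enum_val j == i] is Some j then v 0 j else 0.
have xA j : x (enum_val j) = v 0 j.
  rewrite /x; case: pickP => [k /eqP /enum_val_inj -> //|/(_ j)].
  by rewrite eqxx.
have xNA i : i \notin A -> x i = 0.
  rewrite /x; case: pickP => // k /eqP <-.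
  by rewrite enum_valP.
have sumE F : \sum_i x i * F i = \sum_j v 0 j * F (enum_val j).
  rewrite (bigID (mem A)) /= [X in _ + X]big1 ?addr0; last first.
    by move=> i /xNA ->; rewrite mul0r.
  by rewrite big_enum_val; apply: eq_bigr => j _; rewrite xA.
apply/rowP => j; rewrite mxE -xA; apply: indep => //; split=> [|k].
  have := vM (rshift n ord0); rewrite !mxE => e.
  rewrite -[RHS]e.
  transitivity (\sum_i x i * 1); first by apply: eq_bigr => i _; rewrite mulr1.
  apply: etrans (sumE (fun=> 1)) _.
  by apply: eq_bigr => i _; rewrite mxE row_mxEr mxE.
have := vM (lshift 1 k); rewrite !mxE => e; rewrite -[RHS]e sumE.
by apply: eq_bigr => i _; rewrite mxE row_mxEl.
Qed.

Definition sqdist (p q : 'rV[R]_n) := \sum_(k < n) (p 0 k - q 0 k) ^+ 2.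

Lemma sqdistC p q : sqdist p q = sqdist q p.
Proof. by apply: eq_bigr => k _; rewrite -opprB sqrrN. Qed.

Lemma sqdistxx p : sqdist p p = 0.
Proof. by apply: big1 => k _; rewrite subrr expr0n. Qed.

Lemma sqdist_eq0 p q : sqdist p q = 0 -> p = q.
Proof.
move=> /psumr_eq0P d0; apply/rowP => k; apply/eqP.
by rewrite -subr_eq0 -sqrf_eq0 d0 // => i _; rewrite sqr_ge0.
Qed.

Lemma edist1 p q : edist p q = 1 <-> sqdist p q = 1.
Proof.
split=> [e|]; last by rewrite /edist -/(sqdist p q) => ->; rewrite sqrtr1.
rewrite -[1](expr1n R 2) -e sqr_sqrtr //.
by apply: sumr_ge0 => k _; apply: sqr_ge0.
Qed.

Lemma dependency_sqdist x : affine_dependency x ->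
  exists kappa, forall j, \sum_i x i * sqdist (f i) (f j) = kappa.
Proof.
move=> [x0 xf0].
exists (\sum_i x i * \sum_k f i 0 k ^+ 2) => j.
transitivity (\sum_i \sum_k (x i * f i 0 k ^+ 2 + x i * f j 0 k ^+ 2
    - 2 * f j 0 k * (x i * f i 0 k))).
  by apply: eq_bigr => i _; rewrite big_distrr /=; apply: eq_bigr => k _; ring.
rewrite exchange_big /=.
transitivity (\sum_k \sum_i x i * f i 0 k ^+ 2).
  apply: eq_bigr => k _; rewrite big_split big_split /= sumrN.
  by rewrite -big_distrl -big_distrr /= x0 xf0; ring.
by rewrite exchange_big; apply: eq_bigr => i _; rewrite big_distrr.
Qed.

(* Pairs in different classes are at distance 1, so only the class of [j]
   contributes to the sum once [\sum_i x i = 0] is subtracted. *)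
Lemma dependency_class (c : T -> nat) x :
  (forall i j, c i != c j -> sqdist (f i) (f j) = 1) ->
  affine_dependency x ->
  exists kappa, forall j,
    \sum_(i | c i == c j) x i * (sqdist (f i) (f j) - 1) = kappa.
Proof.
move=> d1 dx; have [kappa xk] := dependency_sqdist dx.
exists kappa => j; rewrite -(xk j) -[RHS]subr0 -[X in _ - X]dx.1 -sumrB.
rewrite [RHS](bigID (fun i => c i == c j)) /= [X in _ = _ + X]big1 ?addr0.
  by apply: eq_bigr => i _; ring.
by move=> i /d1 ->; ring.
Qed.

End LowerBound.

(** * Lower bound when at most two classes have several vertices *)

Section Coarse.
Variables (R : realType) (T : finType) (n : nat) (f : T -> 'rV[R]_n).
Variable (c : T -> nat).
Hypothesis f_inj : injective f.
Hypothesis d1 : forall i j, c i != c j -> sqdist (f i) (f j) = 1.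

Let D i j := sqdist (f i) (f j).

Lemma sqdist_neq0 i j : i != j -> D i j != 0.
Proof. by apply: contra_neq => /sqdist_eq0 /f_inj. Qed.

(** A single point is settled by the sum condition. For two or three distinct points the matrix of
    squared distances is invertible; for three, its determinant is twice the product of the distinct
    off-diagonal entries. *)
Lemma small_class_dependency0 (C : {set T}) x :
  (#|C| <= 3)%N -> \sum_(i in C) x i = 0 ->
  (forall j, j \in C -> \sum_(i in C) x i * D i j = 0) ->
  forall i, i \in C -> x i = 0.
Proof.
have DC i j : D i j = D j i by apply: sqdistC.
have Dii i : D i i = 0 by apply: sqdistxx.
move=> C3 sx sxD i; rewrite -mem_enum => iC.
have {}sxD j : j \in enum C -> \sum_(i <- enum C) x i * D i j = 0.
  by rewrite mem_enum big_enum; apply: sxD.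
move: C3 sx sxD iC (enum_uniq C); rewrite cardE -big_enum /=.
case: (enum C) => [|p [|q [|r [|//]]]] //= _; rewrite ?big_cons big_nil.
- by rewrite addr0 inE => x0 _ /eqP ->.
- move=> _ sxD; rewrite !inE andbT => ipq pq.
  have := sxD p; have := sxD q; rewrite !inE !eqxx orbT !big_cons !big_nil.
  rewrite !Dii (DC q) !mulr0 !addr0 add0r => /(_ isT)/eqP + /(_ isT)/eqP.
  rewrite !mulf_eq0 (negPf (sqdist_neq0 pq)) !orbF.
  by case/orP: ipq => /eqP -> /eqP + /eqP.
move=> _ sxD ipqr; rewrite !inE negb_or !andbT => /andP[/andP[pq pr] qr].
have := sxD r; have := sxD q; have := sxD p.
rewrite !inE !eqxx !orbT !big_cons !big_nil !Dii (DC q p) (DC r p) (DC r q).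
rewrite !mulr0 !addr0 !add0r => /(_ isT) e1 /(_ isT) e2 /(_ isT) e3.
have Dpq := sqdist_neq0 pq; have Dpr := sqdist_neq0 pr.
have Dqr := sqdist_neq0 qr.
(* Elimination: [D p r * E2 + D p q * E3 - D q r * E1] equals [2 * x p * D p q * D p r], and
   similarly for [q] and [r]. *)
have h (y a b : R) : a != 0 -> b != 0 -> 2 * y * a * b = 0 -> y = 0.
  move=> a0 b0 /eqP; rewrite !mulf_eq0 (negPf a0) (negPf b0) !orbF.
  by rewrite pnatr_eq0 /= => /eqP.
pose E1 := x q * D p q + x r * D p r.
pose E2 := x p * D p q + x r * D q r.
pose E3 := x p * D p r + x q * D q r.
move: ipqr; rewrite !inE => /or3P[] /eqP ->.
- apply: (h _ (D p q) (D p r)) => //.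
  transitivity (D p r * E2 + D p q * E3 - D q r * E1).
    by rewrite /E1 /E2 /E3; ring.
  by rewrite /E1 /E2 /E3 e1 e2 e3; ring.
- apply: (h _ (D p q) (D q r)) => //.
  transitivity (D q r * E1 + D p q * E3 - D p r * E2).
    by rewrite /E1 /E2 /E3; ring.
  by rewrite /E1 /E2 /E3 e1 e2 e3; ring.
- apply: (h _ (D p r) (D q r)) => //.
  transitivity (D q r * E1 + D p r * E2 - D p q * E3).
    by rewrite /E1 /E2 /E3; ring.
  by rewrite /E1 /E2 /E3 e1 e2 e3; ring.
Qed.

Lemma triple_dependency0 (u v w : T) (l : nat) x :
  uniq [:: u; v; w] -> (forall i, (c i == c w) = (i \in [:: u; v; w])) ->
  D u w + D v w != D u v ->
  l != c w -> (#|[set i | c i == l]| <= 3)%N ->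
  (forall i j, c i = c j -> c i != c w -> c i != l -> i = j) ->
  affine_dependency f x -> x w = 0 -> forall i, x i = 0.
Proof.
move=> uvw cw Dw lw l3 single dx xw.
have [kappa xk] := dependency_class d1 dx.
have cu : c u = c w by apply/eqP; rewrite cw !inE eqxx.
have cv : c v = c w by apply/eqP; rewrite cw !inE eqxx orbT.
have S3 F : \sum_(i | c i == c w) F i = F u + (F v + F w) :> R.
  rewrite (eq_bigl (mem [:: u; v; w])) // -big_uniq //.
  by rewrite !big_cons big_nil /= addr0.
have := xk u; have := xk v; have := xk w.
rewrite cu cv !S3 xw !mul0r !addr0 !sqdistxx (sqdistC (f v) (f u)).
rewrite -!/(D _ _) => ew ev eu.
have Duv : D u v != 0.
  apply: sqdist_neq0.
  by move: uvw => /= /andP[]; rewrite inE negb_or => /andP[].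
(* The equations at [u] and [v] differ by [(x u - x v) * D u v]. *)
have xuv : x u = x v.
  apply/eqP; rewrite -subr_eq0; apply/eqP/(mulIf Duv); rewrite mul0r.
  by move: (etrans ev (esym eu)) => /eqP; rewrite -subr_eq0 => /eqP <-; ring.
(* Once [x u = x v], the equations at [w] and [u] differ by [x v * (D u w + D v w - D u v)]. *)
have xv : x v = 0.
  have Dw' : D u w + D v w - D u v != 0 by rewrite subr_eq0.
  apply: (mulIf Dw'); rewrite mul0r.
  move: (etrans ew (esym eu)) => /eqP; rewrite -subr_eq0 xuv => /eqP <-.
  by ring.
have xu : x u = 0 by rewrite xuv.
have kappa0 : kappa = 0 by rewrite -eu xu xv; ring.
have x0w i : c i == c w -> x i = 0.
  by rewrite cw !inE => /or3P[] /eqP ->.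
have x0s i : c i != l -> x i = 0.
  move=> il; have [/x0w //|iw] := boolP (c i == c w).
  have := xk i; rewrite kappa0 (big_pred1 i) => [|j].
    by rewrite sqdistxx sub0r mulrN1 => /eqP; rewrite oppr_eq0 => /eqP.
  apply/eqP/eqP => [cji|->//].
  by apply: single => //; rewrite cji.
have sumC F : \sum_(i in [set i | c i == l]) F i = \sum_(i | c i == l) F i :> R.
  by apply: eq_bigl => i; rewrite inE.
have sl : \sum_(i | c i == l) x i = 0.
  rewrite -[RHS]dx.1 [RHS](bigID (fun i => c i == l)) /=.
  by rewrite [X in _ = _ + X]big1 ?addr0.
move=> i; have [il|/x0s//] := boolP (c i == l).
apply: (small_class_dependency0 l3); rewrite ?sumC ?inE // => j; rewrite inE.
move=> /eqP cj; rewrite sumC -[RHS]kappa0 -(xk j) cj.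
rewrite -[LHS]subr0 -[X in _ - X]sl -sumrB.
by apply: eq_bigr => k _; rewrite /D; ring.
Qed.

(* A triangle has at most one right angle, so the vertex to drop, [v] or [w],
   can be chosen with no right angle there. *)
Lemma coarse_card (k l : nat) :
  k != l -> #|[set i | c i == k]| = 3 -> (#|[set i | c i == l]| <= 3)%N ->
  (forall i j, c i = c j -> c i != k -> c i != l -> i = j) ->
  (#|T| <= n.+2)%N.
Proof.
move=> kl k3 l3 single.
suff [w indep] : exists w, forall x, affine_dependency f x -> x w = 0 ->
    forall i, x i = 0.
  have: (#|[set~ w]| <= n.+1)%N.
    apply: (@affine_independent_card _ _ _ f) => x dx x0; apply: indep => //.
    by apply: x0; rewrite !inE eqxx.
  by rewrite cardsC1; case: #|T|.
have kE i : (c i == k) = (i \in enum [set i | c i == k]).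
  by rewrite mem_enum inE.
move: k3 kE (enum_uniq [set i | c i == k]); rewrite cardE.
case: (enum _) => [|u [|v [|w []]]] // _ kE uvw.
have cv : c v = k by apply/eqP; rewrite kE !inE eqxx orbT.
have cw : c w = k by apply/eqP; rewrite kE !inE eqxx !orbT.
have [Dw|Dw] := eqVneq (D u w + D v w) (D u v); last first.
  by exists w => x; apply: triple_dependency0 Dw _ l3 _; rewrite ?cw // eq_sym.
exists v => x; apply: (@triple_dependency0 u w v) l3 _; rewrite ?cv //.
- move: uvw; rewrite /= !inE !negb_or !andbT eq_sym (eq_sym w).
  by move=> /andP[/andP[-> ->] ->].
- by move=> i; rewrite kE !inE; congr (_ || _); rewrite orbC.
(* Right angles at both [w] and [v] would give [2 * D v w = 0]. *)
- have vw : v != w by move: uvw => /= /andP[_]; rewrite inE andbT.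
  have := sqdist_neq0 vw; apply: contra_neq; rewrite -Dw (_ : D w v = D v w).
    lra.
  exact: sqdistC.
- by rewrite eq_sym.
Qed.

End Coarse.

Lemma multipartite_lower_bound (R : realType) (T : finType) (c : T -> nat)
    (n k l : nat) :
  k != l -> #|[set i | c i == k]| = 3 -> (#|[set i | c i == l]| <= 3)%N ->
  (forall i j, c i = c j -> c i != k -> c i != l -> i = j) ->
  representable R (multipartite c) n -> (#|T| <= n.+2)%N.
Proof.
move=> kl k3 l3 single [f [f_inj f1]].
apply: (@coarse_card R T n f c _ _ k l) => // [i j|i j cij].
  by apply: f_inj; rewrite inE.
by apply/edist1/f1; rewrite ?inE // adj_multipartite.
Qed.

(** * Counting and locating the vertices of [Gabc] *)

Lemma card_tag_set (I : finType) (T_ : I -> finType) (P : pred I) :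
  #|[set x : {i : I & T_ i} | P (tag x)]| = (\sum_(i | P i) #|T_ i|)%N.
Proof.
rewrite -sum1_card.
rewrite (eq_bigl (fun x => P (tag x) && true)) => [|x]; last first.
  by rewrite inE andbT.
rewrite -(sig_big_dep P (fun _ _ => true) (fun _ _ => 1%N)) /=.
by apply: eq_bigr => i _; rewrite sum1_card.
Qed.

Lemma card_Gvertex_class (a b c : nat) (P : pred nat) :
  #|[set x : Gvertex a b c | P (tag x)]|
  = (\sum_(0 <= i < a + b + c | P i) part_size a b i)%N.
Proof.
rewrite (@card_tag_set _ _ (fun i : 'I_(a + b + c) => P i)) big_mkord.
by apply: eq_bigr => i _; rewrite card_ord.
Qed.

Lemma card_Gvertex (a b c : nat) :
  #|Gvertex a b c| = (a + b * 2 + c * 3)%N.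
Proof.
rewrite -cardsT.
have -> : [set: Gvertex a b c] = [set x : Gvertex a b c | predT (val (tag x))].
  by apply/setP => x; rewrite !inE.
rewrite card_Gvertex_class (@big_cat_nat _ _ _ (a + b)) ?leq_addr //=.
rewrite (@big_cat_nat _ _ _ a) ?leq_addr //=.
rewrite (@eq_big_nat _ _ _ 0 a _ (fun=> 1%N)); last first.
  by move=> i /andP[_ ia]; rewrite /part_size ia.
rewrite (@eq_big_nat _ _ _ a (a + b) _ (fun=> 2%N)); last first.
  by move=> i /andP[ia ib]; rewrite /part_size ltnNge ia ib.
rewrite (@eq_big_nat _ _ _ (a + b) _ _ (fun=> 3%N)); last first.
  move=> i /andP[ia _]; rewrite /part_size !ltnNge ia.
  by rewrite (leq_trans (leq_addr _ _) ia).
by rewrite !sum_nat_const_nat; lia.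
Qed.

(** Natural numbers replace the dependent ordinals, so that case analysis on vertices becomes linear
    arithmetic. *)
Definition part (a b c : nat) (x : Gvertex a b c) : nat := tag x.

Definition pos (a b c : nat) (x : Gvertex a b c) : nat := tagged x.

Lemma Gvertex_inj (a b c : nat) (x y : Gvertex a b c) :
  part x = part y -> pos x = pos y -> x = y.
Proof.
rewrite /part /pos; case: x y => [i u] [j v] /= /val_inj ij.
by subst j => /val_inj ->.
Qed.

Lemma Gvertex_bound (a b c : nat) (x : Gvertex a b c) :
  (part x < a + b + c)%N /\
  ((part x < a)%N /\ pos x = 0 \/
   (a <= part x < a + b)%N /\ (pos x < 2)%N \/
   (a + b <= part x)%N /\ (pos x < 3)%N).
Proof.
split; first exact: ltn_ord.
have := ltn_ord (tagged x); rewrite -/(pos x) -/(part x) /part_size.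
by case: ifP => ia; [|case: ifP => ib]; lia.
Qed.

Lemma Gedges_multipartite (a b c : nat) :
  Gedges a b c = multipartite_edges (@part a b c).
Proof. by []. Qed.

(** Injectivity has to be checked only inside a part: points of different parts are at distance 1,
    hence distinct. *)
Lemma representable_Gabc (R : realType) (a b c n : nat)
    (f : Gvertex a b c -> 'rV[R]_n) :
  (forall x y : Gvertex a b c, (part x < part y)%N -> sqdist (f x) (f y) = 1) ->
  (forall x y : Gvertex a b c, part x = part y -> f x = f y ->
     pos x = pos y) ->
  representable R (Gabc a b c) n.
Proof.
move=> f_lt f_tag.
have f1 (x y : Gvertex a b c) : part x != part y -> sqdist (f x) (f y) = 1.
  by rewrite neq_ltn => /orP[/f_lt //|/f_lt]; rewrite sqdistC.
exists f; split=> x y _ _.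
  move=> fxy; have [txy|/f1] := eqVneq (part x) (part y).
    by apply: Gvertex_inj txy (f_tag _ _ txy fxy).
  by rewrite fxy sqdistxx => /esym/eqP; rewrite oner_eq0.
rewrite /adj /= Gedges_multipartite -/(adj (multipartite _) x y).
by rewrite adj_multipartite => /f1 /edist1.
Qed.

(** * Explicit representations *)

Section UpperBounds.
Variable R : realType.

Let s : R := Num.sqrt 2^-1.

Let s2 : s ^+ 2 = 2^-1.
Proof. by rewrite sqr_sqrtr // invr_ge0 ler0n. Qed.

Let s_neq0 : s != 0.
Proof. by rewrite -sqrf_eq0 s2 invr_eq0 pnatr_eq0. Qed.

Definition axis n (k : nat) (r : R) : 'rV[R]_n :=
  \row_(i < n) if i == k :> nat then r else 0.

Lemma sqdist_axis n k l r t : (k < n)%N -> (l < n)%N -> k != l ->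
  sqdist (axis n k r) (axis n l t) = r ^+ 2 + t ^+ 2.
Proof.
move=> kn ln kl; rewrite /sqdist (bigD1 (Ordinal kn)) //=.
rewrite (bigD1 (Ordinal ln)) /=; last by rewrite -val_eqE /= eq_sym.
rewrite !mxE /= !eqxx (negPf kl) eq_sym (negPf kl) big1 ?addr0 => [|i].
  by rewrite subr0 sub0r sqrrN.
rewrite -!val_eqE /= => /andP[/negPf ik /negPf il].
by rewrite !mxE ik il subr0 expr0n.
Qed.

(* The parts of size at most 2 lie on their own axes; the part of size 3 takes
   both ends of one axis and one end of another. *)
Lemma representable_cross (a b c : nat) :
  (c <= 1)%N -> representable R (Gabc a b c) (a + b + c * 2).
Proof.
move=> c1; set n := (_ + _)%N.
(* Positions 0 and 1 share the axis of their part. Position 2 occurs only in the last part, so the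
   next axis is free. *)
pose k (x : Gvertex a b c) := (part x + (pos x)./2)%N.
pose f x := axis n (k x) ((-1) ^+ pos x * s).
have kn x : (k x < n)%N.
  by have := Gvertex_bound x; rewrite /k /n; lia.
have fs (x : Gvertex a b c) : ((-1) ^+ pos x * s) ^+ 2 = 2^-1 :> R.
  by rewrite exprMn sqrr_sign mul1r.
apply: (@representable_Gabc R a b c n f) => x y.
  move=> xy; rewrite sqdist_axis // ?fs; first by lra.
  by have := Gvertex_bound x; have := Gvertex_bound y; rewrite /k; lia.
move=> txy /rowP /(_ (Ordinal (kn x))); rewrite !mxE /= eqxx.
case: eqP => [kxy|_ /eqP]; last first.
  by rewrite mulf_eq0 signr_eq0 (negPf s_neq0).
(* The axis gives the half of [pos] and the sign its parity. *)
move/(mulIf s_neq0); rewrite -signr_odd -[in RHS]signr_odd => sxy.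
have : odd (pos x) = odd (pos y) by apply: (@signr_inj R).
by move: kxy; rewrite /k; lia.
Qed.

(* [t 0] and [t 1] are the roots of a t^2 - 2 s t - 1/2 = 0: the point
   (t, ..., t) of R^a is at distance 1 from all the points [s e_i]. A third
   vertex of the last part goes to [s e_a]. *)
Lemma representable_simplex (a b c : nat) :
  (0 < a)%N -> (b + c = 1)%N -> representable R (Gabc a b c) (a + c).
Proof.
move=> a0 bc; set n := (a + c)%N.
pose A : R := a%:R.
have A0 : A != 0 by rewrite pnatr_eq0 -lt0n.
have Ap : 0 < A by rewrite ltr0n.
(* A quarter of the discriminant of the quadratic, [s ^+ 2 + A / 2]. *)
pose d := Num.sqrt ((1 + A) / 2).
have d2 : d ^+ 2 = (1 + A) / 2 by rewrite sqr_sqrtr //; lra.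
have d0 : d != 0 by rewrite -sqrf_eq0 d2; apply: lt0r_neq0; lra.
pose t (j : nat) : R := if (j < 2)%N then (s + (-1) ^+ j * d) / A else 0.
have tE j : (j < 2)%N -> A * t j ^+ 2 - 2 * s * t j = 2^-1.
  move=> j2; rewrite /t j2.
  have -> : A * ((s + (-1) ^+ j * d) / A) ^+ 2
      - 2 * s * ((s + (-1) ^+ j * d) / A)
    = (((-1) ^+ j * d) ^+ 2 - s ^+ 2) / A by field.
  by rewrite exprMn sqrr_sign mul1r d2 s2; field.
have t0 j : (j < 2)%N -> t j != 0.
  move=> j2; apply/eqP => tj; have := tE j j2; rewrite tj.
  lra.
pose apex j : 'rV[R]_n := \row_(i < n) if (i < a)%N then t j else 0.
pose f (x : Gvertex a b c) :=
  if (part x < a)%N then axis n (part x) s else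
  if (pos x < 2)%N then apex (pos x) else axis n a s.
apply: (@representable_Gabc R a b c n f) => x y.
  move=> xy; rewrite /f.
  have bx := Gvertex_bound x; have by1 := Gvertex_bound y.
  have xa : (part x < a)%N by lia.
  have xn : (part x < n)%N by rewrite /n; lia.
  rewrite xa; case: ifP => ya.
    rewrite sqdist_axis ?s2 //; [lra|rewrite /n; lia|lia].
  case: ifP => y2; last first.
    rewrite sqdist_axis ?s2 //; [lra| |lia].
    by rewrite /n; lia.
  rewrite /sqdist (bigD1 (Ordinal xn)) //= !mxE /= eqxx xa.
  under eq_bigr => i ix.
    rewrite !mxE -[X in if X then s else 0]/(i == Ordinal xn) (negPf ix).
    rewrite sub0r sqrrN.
    over.
  have -> : \sum_(i < n | i != Ordinal xn)
      (if (i < a)%N then t (pos y) else 0) ^+ 2 = (A - 1) * t (pos y) ^+ 2.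
    transitivity (\sum_(i < n) (if (i < a)%N then t (pos y) else 0) ^+ 2
        - t (pos y) ^+ 2).
      by rewrite [in RHS](bigD1 (Ordinal xn)) //= xa; ring.
    rewrite big_split_ord /= [X in _ + X - _]big1 => [|i _]; last first.
      by rewrite ltnNge leq_addr expr0n.
    under eq_bigr do rewrite ltn_ord.
    by rewrite sumr_const card_ord -mulr_natl -/A; ring.
  transitivity (s ^+ 2 + (A * t (pos y) ^+ 2 - 2 * s * t (pos y))).
    by ring.
  by rewrite tE // s2; lra.
move=> txy; have bx := Gvertex_bound x; have by1 := Gvertex_bound y.
rewrite /f -txy; case: ifP => xa.
  by move=> _; lia.
have n0 : (0 < n)%N by rewrite /n; lia.
have j3 (z : Gvertex a b c) : (pos z < 3)%N.
  by have := Gvertex_bound z; lia.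
(* The default value 0 of [t] is also the first coordinate of [axis n a s], so the first coordinate
   alone separates the vertices of the last part. *)
have fE (j : nat) :
    (if (j < 2)%N then apex j else axis n a s) 0 (Ordinal n0) = t j.
  rewrite /t; case: ifP => j2; rewrite mxE /= ?a0 /t ?j2 //.
  by rewrite eq_sym eqn0Ngt a0.
move/rowP/(_ (Ordinal n0)); rewrite !fE.
have t01 : t 0 != t 1.
  apply/eqP; rewrite /t /= => /(mulIf (invr_neq0 A0)) /addrI.
  rewrite expr0 expr1 mul1r mulN1r => dN; move/eqP: d0; apply.
  by lra.
have t2 : t 2 = 0 by [].
move: (j3 x) (j3 y); move: (pos x) (pos y).
move=> [|[|[|//]]] [|[|[|//]]] //= _ _ /eqP.
- by rewrite (negPf t01).
- by rewrite t2 (negPf (t0 _ _)).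
- by rewrite eq_sym (negPf t01).
- by rewrite t2 (negPf (t0 _ _)).
- by rewrite t2 eq_sym (negPf (t0 _ _)).
- by rewrite t2 eq_sym (negPf (t0 _ _)).
Qed.

End UpperBounds.

(** * Merging two parts of [Gabc] *)

Definition merge (p q i : nat) : nat := if i == q then p else i.

(** [N] is the number of vertices minus 2, where the lower bound for the merged graph meets the
    given representation. The label [l] may belong to an empty class. *)
Lemma Gabc_not_critical (R : realType) (a b c p q k l N : nat) :
  (p < q < a + b + c)%N -> (p == k) || (p == l) -> k != l ->
  (\sum_(0 <= i < a + b + c | merge p q i == k) part_size a b i = 3)%N ->
  (\sum_(0 <= i < a + b + c | merge p q i == l) part_size a b i <= 3)%N ->
  (forall i, (i < a + b + c)%N -> merge p q i != k -> merge p q i != l ->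
     part_size a b i = 1%N) ->
  (N.+2 = a + b * 2 + c * 3)%N -> representable R (Gabc a b c) N ->
  ~ dimension_critical R (Gabc a b c).
Proof.
move=> /andP[pq qn] pkl kl k3 l3 single NE rep.
pose g (x : Gvertex a b c) := merge p q (part x).
apply: (@not_critical_multipartite R _ _ g N) => //=.
  have sz i : (0 < part_size a b i)%N
    by rewrite /part_size; case: ifP => _; [|case: ifP].
  pose x : Gvertex a b c :=
    Tagged (fun i : 'I__ => 'I_(part_size a b i))
      (i := Ordinal (ltn_trans pq qn)) (Ordinal (sz _)).
  pose y : Gvertex a b c :=
    Tagged (fun i : 'I__ => 'I_(part_size a b i))
      (i := Ordinal qn) (Ordinal (sz _)).
  rewrite Gedges_multipartite; apply/properP; split.
    apply/subsetP => e; rewrite !inE.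
    move=> /existsP[u /existsP[v /andP[uv /eqP->]]].
    apply/existsP; exists u; apply/existsP; exists v; rewrite eqxx andbT.
    by apply: contra_neq uv; rewrite /g => ->.
  (* An edge between the merged parts is lost. *)
  exists [set x; y].
    by rewrite -/(adj (multipartite _) x y) adj_multipartite /= neq_ltn pq.
  rewrite -/(adj (multipartite _) x y) adj_multipartite /g /merge /= eqxx.
  by rewrite (ltn_eqF pq) eqxx.
move=> n /(@multipartite_lower_bound R _ g n k l kl).
rewrite card_Gvertex -NE !ltnS; apply.
- by rewrite (@card_Gvertex_class _ _ _ (fun i => merge p q i == k)).
- by rewrite (@card_Gvertex_class _ _ _ (fun i => merge p q i == l)).
move=> x y gxy gxk gxl.
have pos0 z : g z != k -> g z != l -> pos z = 0%N.
  move=> zk zl; have := ltn_ord (tagged z); rewrite -/(pos z).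
  by rewrite (single (part z)) ?ltn_ord //; case: (pos z).
apply: Gvertex_inj; last by rewrite !pos0 -?gxy.
move: gxy gxk gxl pkl; rewrite /g /merge.
by case: ifP => ?; case: ifP => ?; lia.
Qed.

(** Reduces a class size over a symbolic number of parts to a sum over the last few parts. *)
Lemma sum_nat_tail (m d : nat) (P : pred nat) (F : nat -> nat) :
  (forall i, (i < m)%N -> ~~ P i) ->
  (\sum_(0 <= i < m + d | P i) F i
   = \sum_(0 <= i < d) if P (m + i)%N then F (m + i)%N else 0)%N.
Proof.
move=> Pm; rewrite (@big_cat_nat _ _ _ m) ?leq_addr //=.
rewrite big_nat_cond big1 ?add0n.
  rewrite -{1}[m]add0n big_addn addKn -big_mkcond /=.
  by apply: eq_big => i; rewrite addnC.
by move=> i /andP[/Pm /negPf ->].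
Qed.

(** A constant labelling leaves two isolated vertices, which would coincide in dimension 0. *)
Lemma K2_not_critical (R : realType) :
  ~ dimension_critical R (complete_graph 2).
Proof.
apply: (@not_critical_multipartite R _ _ (fun=> 0%N) 1) => //=.
- apply/properP; split.
    by apply/subsetP => e; rewrite inE => /existsP[x /existsP[y]]; rewrite eqxx.
  exists [set ord0; ord_max]; first by rewrite inE cards2.
  by rewrite -/(adj (multipartite _) _ _) adj_multipartite.
- exists (fun i : 'I_2 => const_mx (i : nat)%:R); split=> x y _ _.
    move=> /rowP/(_ ord0); rewrite !mxE => /eqP.
    by rewrite eqr_nat => /eqP/val_inj.
  move=> xy; apply/edist1; rewrite /sqdist big_ord1 !mxE.
  have {xy} : x != y.
    by move: xy; rewrite /adj inE cards2; case: (eqVneq x y).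
  case: x => [[|[]]] // ?; case: y => [[|[]]] //= ? _;
    by rewrite ?sub0r ?subr0 ?sqrrN expr1n.
case=> [[f [f_inj _]]|//].
have := f_inj ord0 ord_max.
by rewrite !inE (thinmx0 (f ord0)) (thinmx0 (f ord_max)) => /(_ isT isT erefl).
Qed.

(** Innermost conditions are split first: one that contains another conditional is skipped until
    that one is resolved. *)
Ltac merge_cases :=
  rewrite /merge /part_size;
  repeat match goal with
  | |- context [if ?b then _ else _] =>
      match b with
      | context [if _ then _ else _] => fail 1
      | _ => let H := fresh in destruct b eqn:H
      end
  end; lia.

Ltac class_sum m d :=
  rewrite (_ : (_ + _ + _ = m + d)%N); [|lia];
  rewrite sum_nat_tail; [|by move=> i im; merge_cases];
  rewrite !big_nat_recr //= big_geq //; merge_cases.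

Theorem theorem2p5 (R : realType) :
  ~ dimension_critical R (complete_graph 2) /\
  (forall a : nat, (1 <= a)%N -> ~ dimension_critical R (Gabc a 1 0)) /\
  (forall a : nat, (1 <= a)%N -> ~ dimension_critical R (Gabc a 1 1)) /\
  (forall a : nat, (1 <= a)%N -> ~ dimension_critical R (Gabc a 2 0)) /\
  (forall a : nat, (2 <= a)%N -> ~ dimension_critical R (Gabc a 0 1)).
Proof.
split; first exact: K2_not_critical.
split; [|split; [|split]] => a.
- case: a => // a _.
  (* The last singleton is merged with the pair; the label [l = a.+1] is emptied by the merge. *)
  apply: (@Gabc_not_critical R a.+1 1 0 a a.+1 a a.+1 a.+1);
    rewrite ?eqxx //; try lia.
  + by class_sum a 2%N.
  + by class_sum a 2%N.
  + by move=> i; merge_cases.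
  + by have := @representable_simplex R a.+1 1 0 isT erefl; rewrite addn0.
- case: a => // a _.
  (* Same merge; [l] is the part of size 3. *)
  apply: (@Gabc_not_critical R a.+1 1 1 a a.+1 a a.+2 a.+4);
    rewrite ?eqxx //; try lia.
  + by class_sum a 3%N.
  + by class_sum a 3%N.
  + by move=> i; merge_cases.
  + by have := @representable_cross R a.+1 1 1 isT; rewrite !addnS !addn0.
- case: a => // a _.
  (* A singleton is merged with the first pair; [l] is the second pair. *)
  apply: (@Gabc_not_critical R a.+1 2 0 a a.+1 a a.+2 a.+3);
    rewrite ?eqxx //; try lia.
  + by class_sum a 3%N.
  + by class_sum a 3%N.
  + by move=> i; merge_cases.
  + by have := @representable_cross R a.+1 2 0 isT; rewrite !addnS !addn0.
- case: a => [|[|a]] // _.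
  (* Here two singletons are merged into the class [l], and [k] is the original part of size 3. *)
  apply: (@Gabc_not_critical R a.+2 0 1 a a.+1 a.+2 a a.+3);
    rewrite ?eqxx ?orbT //; try lia.
  + by class_sum a 3%N.
  + by class_sum a 3%N.
  + by move=> i; merge_cases.
  + by have := @representable_simplex R a.+2 0 1 isT erefl; rewrite addn1.
Qed.
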